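(* Let $b>0$, $a\in\mathbb{R}$, $\sigma>0$, $\rho>0$, $\ell>0$, $\lambda>0$, $c>0$ and $I>k>0$. Let $\psi_\rho$ be the strictly increasing positive fundamental solution of $\frac12\sigma^2v''(x)+(a-bx)v'(x)-\rho v(x)=0$ on $\mathbb{R}$, let $$\beta:=\Big(I-k-\frac ab\frac{\ell}{\rho}-\frac{\lambda c}{\rho}\Big)\frac{\rho+b}{\ell}+\frac ab ,$$ and let $x^*$ be the optimal threshold characterized by the equation $$(x^*-\beta)\,\psi_\rho'(x^* )-\psi_\rho(x^* )=0 .$$ For each of the parameters $\ell,\lambda,c,k$, regard $x^*$ as a function of that parameter with all the other parameters held fixed. Then $x^*$ is differentiable in that parameter and: (i) $\displaystyle \frac{\partial x^*}{\partial \ell}=-\frac{(\psi_\rho'(x^* ))^2}{\psi_\rho''(x^* )\,\psi_\rho(x^* )}\,\frac{\rho+b}{\ell^2}\Big(I-k-\frac{\lambda c}{\rho}\Big)$, so that $\frac{\partial x^*}{\partial \ell}<0$ if $I-k-\frac{\lambda c}{\rho}>0$ and $\frac{\partial x^*}{\partial \ell}>0$ if $I-k-\frac{\lambda c}{\rho}<0$; (ii) $\displaystyle \frac{\partial x^*}{\partial \lambda}=-\frac{(\psi_\rho'(x^* ))^2}{\psi_\rho(x^* )\,\psi_\rho''(x^* )}\,\frac{c}{\rho}\,\frac{\rho+b}{\ell}<0$; (iii) $\displaystyle \frac{\partial x^*}{\partial c}=-\frac{(\psi_\rho'(x^* ))^2}{\psi_\rho(x^* )\,\psi_\rho''(x^*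 )}\,\frac{\lambda}{\rho}\,\frac{\rho+b}{\ell}<0$; (iv) $\displaystyle \frac{\partial x^*}{\partial k}=-\frac{(\psi_\rho'(x^* ))^2}{\psi_\rho(x^* )\,\psi_\rho''(x^* )}\,\frac{\rho+b}{\ell}<0$.
   Context: Setting: $X$ is the Ornstein–Uhlenbeck process $dX_t=(a-bX_t)\,dt+\sigma\,dW_t$, $X_0=x\in\mathbb{R}$. The optimal stopping problem is $$\inf_{\tau\ge0}\mathbb{E}_x\Big[\int_0^\tau e^{-\rho t}(\ell X_t+\lambda c)\,dt+e^{-\rho\tau}(I-k)\Big],$$ and $x^*$ is the trigger level such that $\tau^*=\inf\{t\ge0:X_t\ge x^*\}$ is optimal; it is completely characterized by the algebraic equation in the claim. Up to a positive multiplicative constant, $\psi_\rho$ is $$\psi_\rho(x)=e^{\frac{(bx-a)^2}{2\sigma^2b}}D_{-\rho/b}\Big(-\frac{bx-a}{\sigma b}\sqrt{2b}\Big),$$ where $D_\theta(y)=e^{-y^2/4}\frac{1}{\Gamma(-\theta)}\int_0^\infty t^{-\theta-1}e^{-t^2/2-yt}\,dt$ for $\theta<0$ is the parabolic cylinder function. Note that $\psi_\rho$ does not depend on $\ell,\lambda,c,k$. *)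

(* Defs.v *)
From Stdlib Require Import Reals.
From Coquelicot Require Import Coquelicot.
Open Scope R_scope.

(* The strictly increasing positive fundamental solution of
     (1/2) sigma^2 v'' + (a - b x) v' - rho v = 0   on the real line.
   For b, sigma, rho > 0 both endpoints are natural boundaries of the
   Ornstein-Uhlenbeck process, so these conditions determine psi up to a positive
   multiplicative constant, without any further boundary condition: adding a
   nonzero multiple of the decreasing solution, which tends to +oo at -oo, destroys
   either monotonicity or positivity. *)
Record increasing_fundamental_solution (a b sigma rho : R) (psi : R -> R) : Prop := {
  ifs_derivable : forall x : R, ex_derive psi x;
  ifs_derivable2 : forall x : R, ex_derive (Derive psi) x;
  ifs_ode : forall x : R,
    / 2 * sigma ^ 2 * Derive_n psi 2 x + (a - b * x) * Derive psi x - rho * psi x = 0;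
  ifs_pos : forall x : R, 0 < psi x;
  ifs_increasing : forall x y : R, x < y -> psi x < psi y
}.

Definition beta (a b rho I ell lam c k : R) : R :=
  (I - k - a / b * (ell / rho) - lam * c / rho) * ((rho + b) / ell) + a / b.

(* The equation is invariant under multiplication of psi by a nonzero constant. *)
Definition threshold_equation (psi : R -> R) (bet x : R) : Prop :=
  (x - bet) * Derive psi x - psi x = 0.

(* Main.v *)
Require Import Defs.
From Stdlib Require Import Reals Lra.
From Coquelicot Require Import Coquelicot.
Open Scope R_scope.

(** For the increasing positive solution [psi], the product of [psi''] with the
    integrating factor [exp (2 / sigma^2 * (a x - b x^2 / 2))] has derivative a positive
    multiple of [psi'].  Hence if [psi'' <= 0] at some [x0], then [psi'' <= 0] on
    all of [(-oo, x0]], so [psi' >= psi' x0 > 0] there and [psi] would become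
    negative near [-oo].  So [psi] is strictly convex, and
    [G x = x - psi x / psi' x], whose derivative is [psi psi'' / psi'^2], is
    strictly increasing.  The threshold equation is [G xstar = beta], and the
    sensitivities are the derivatives of the inverse function of [G] composed
    with [beta]. *)

(** * Monotonicity and signs of derivatives on the real line *)

Lemma Derive_n_2 (f : R -> R) (x : R) : Derive_n f 2 x = Derive (Derive f) x.
Proof. reflexivity. Qed.

Lemma derive_nonneg_le (f df : R -> R) (x y : R) :
  (forall t, x <= t <= y -> is_derive f t (df t)) ->
  (forall t, x <= t <= y -> 0 <= df t) ->
  x <= y -> f x <= f y.
Proof.
  intros Hd Hp Hxy.
  destruct (MVT_gen f x y df) as [c [Hc E]];
    rewrite ?(Rmin_left x y), ?(Rmax_right x y) in * by lra.
  - intros t Ht. apply Hd. lra.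
  - intros t Ht. apply derivable_continuous_pt.
    exists (df t). apply is_derive_Reals. now apply Hd.
  - assert (0 <= df c) by now apply Hp. nra.
Qed.

Lemma derive_pos_lt (f df : R -> R) :
  (forall t, is_derive f t (df t)) -> (forall t, 0 < df t) ->
  forall x y, x < y -> f x < f y.
Proof.
  intros Hd Hp x y Hxy.
  destruct (MVT_gen f x y df) as [c [Hc E]].
  - intros t _. apply Hd.
  - intros t _. apply derivable_continuous_pt.
    exists (df t). now apply is_derive_Reals.
  - assert (0 < df c) by now apply Hp. nra.
Qed.

Lemma increasing_derive_nonneg (f : R -> R) (x : R) :
  (forall u v, u < v -> f u < f v) -> ex_derive f x -> 0 <= Derive f x.
Proof.
  intros Hinc Hex. destruct (Rle_lt_dec 0 (Derive f x)) as [H|H]; [exact H|exfalso].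
  apply Derive_correct, is_derive_Reals in Hex.
  (* With tolerance [- Derive f x], every difference quotient of small step stays below 0, while the
     one of step [d / 2] is positive because [f] increases. *)
  destruct (Hex (- Derive f x)) as [d Hd]; [lra|].
  assert (Hd0 := cond_pos d).
  specialize (Hd (d / 2)).
  assert (Hq : 0 < (f (x + d / 2) - f x) / (d / 2)).
  { apply Rdiv_lt_0_compat; [|lra]. assert (f x < f (x + d / 2)) by (apply Hinc; lra). lra. }
  assert (d / 2 <> 0) by lra.
  assert (Rabs (d / 2) < d) by (rewrite Rabs_pos_eq; lra).
  specialize (Hd H0 H1). apply Rabs_def2 in Hd. lra.
Qed.

Lemma derive_at_min (f : R -> R) (x : R) :
  ex_derive f x -> (forall y, f x <= f y) -> Derive f x = 0.
Proof.
  intros Hex Hmin.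
  assert (pr : derivable_pt f x).
  { exists (Derive f x). apply is_derive_Reals. now apply Derive_correct. }
  rewrite <- (Derive_Reals f x pr).
  apply deriv_minimum with (x - 1) (x + 1); try lra. auto.
Qed.

(** * Strict convexity of the fundamental solution *)

Section FundamentalSolution.

Context (a b sigma rho : R) (psi : R -> R).
Hypotheses (hb : 0 < b) (hsigma : 0 < sigma) (hrho : 0 < rho).
Hypothesis hpsi : increasing_fundamental_solution a b sigma rho psi.

Lemma ifs_derive2_eq (x : R) :
  Derive (Derive psi) x = 2 / sigma ^ 2 * (rho * psi x - (a - b * x) * Derive psi x).
Proof.
  assert (H := ifs_ode _ _ _ _ _ hpsi x). rewrite Derive_n_2 in H.
  replace (rho * psi x) with
    (/ 2 * sigma ^ 2 * Derive (Derive psi) x + (a - b * x) * Derive psi x) by lra.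
  field. lra.
Qed.

(** Only two derivatives of [psi] are assumed; the third exists because the equation expresses
    [psi''] through [psi] and [psi'], and differentiating that expression gives the value. *)
Lemma ifs_is_derive2 (x : R) :
  is_derive (Derive (Derive psi)) x
    (2 / sigma ^ 2 * ((rho + b) * Derive psi x - (a - b * x) * Derive (Derive psi) x)).
Proof.
  apply is_derive_ext with
    (fun t => 2 / sigma ^ 2 * (rho * psi t - (a - b * t) * Derive psi t)).
  { intros t. symmetry. apply ifs_derive2_eq. }
  assert (H1 := ifs_derivable _ _ _ _ _ hpsi x).
  assert (H2 := ifs_derivable2 _ _ _ _ _ hpsi x).
  auto_derive.
  - tauto.
  - change (Derive (fun x => psi x) x) with (Derive psi x).
    change (Derive (fun x => Derive psi x) x) with (Derive (Derive psi) x).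
    field. lra.
Qed.

(** Since [psi' >= 0], a zero of [psi'] is a minimum of [psi'], so [psi''] vanishes there too. The
    equation then reduces to [rho * psi x = 0], against positivity of [psi]. *)
Lemma ifs_derive_pos (x : R) : 0 < Derive psi x.
Proof.
  assert (Hge : forall y, 0 <= Derive psi y).
  { intros y. apply increasing_derive_nonneg.
    - apply (ifs_increasing _ _ _ _ _ hpsi).
    - apply (ifs_derivable _ _ _ _ _ hpsi). }
  destruct (Hge x) as [H|H]; [exact H|exfalso].
  assert (H2 : Derive (Derive psi) x = 0).
  { apply derive_at_min; [apply (ifs_derivable2 _ _ _ _ _ hpsi)|].
    intros y. rewrite <- H. apply Hge. }
  assert (Hode := ifs_ode _ _ _ _ _ hpsi x).
  rewrite Derive_n_2, H2, <- H in Hode.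
  assert (Hp := ifs_pos _ _ _ _ _ hpsi x). nra.
Qed.

Lemma ifs_derive2_pos (x : R) : 0 < Derive (Derive psi) x.
Proof.
  destruct (Rlt_le_dec 0 (Derive (Derive psi) x)) as [H|H]; [exact H|exfalso].
  assert (Hneg : forall t, t <= x -> Derive (Derive psi) t <= 0).
  { set (E := fun t => exp (2 / sigma ^ 2 * (a * t - b * t ^ 2 / 2))).
    assert (HE : forall t, 0 < E t) by (intros t; apply exp_pos).
    assert (Hmono := derive_pos_lt (fun t => E t * Derive (Derive psi) t)
      (fun t => E t * (2 / sigma ^ 2 * ((rho + b) * Derive psi t)))).
    intros t [Ht | ->]; [|exact H].
    assert (Hlt : E t * Derive (Derive psi) t < E x * Derive (Derive psi) x).
    { apply Hmono; [| |exact Ht].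
      - intros s.
        assert (D2 := ifs_is_derive2 s).
        assert (DE : is_derive E s (E s * (2 / sigma ^ 2 * (a - b * s)))).
        { unfold E. rewrite (Rmult_comm (exp _)).
          apply (is_derive_comp exp (fun t => 2 / sigma ^ 2 * (a * t - b * t ^ 2 / 2))).
          - apply is_derive_exp.
          - auto_derive; [exact Logic.I|]. field. lra. }
        (* The drift term [- (a - b * s) * psi''] in [psi'''] cancels against the contribution of
           [E']; only the term in [psi'] survives. *)
        assert (DP := is_derive_mult E _ s _ _ DE D2 Rmult_comm).
        match type of DP with is_derive _ _ ?d =>
          replace (E s * (2 / sigma ^ 2 * ((rho + b) * Derive psi s))) with d
        end; [exact DP|].
        unfold plus, mult; simpl. field. lra.
      - intros s. apply Rmult_lt_0_compat; [apply HE|].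
        apply Rmult_lt_0_compat; [apply Rdiv_lt_0_compat; [lra|nra]|].
        apply Rmult_lt_0_compat; [lra|apply ifs_derive_pos]. }
    assert (H1 := HE t). assert (H2 := HE x). nra. }
  set (m := Derive psi x).
  assert (Hm : 0 < m) by apply ifs_derive_pos.
  assert (Hw : forall t, t <= x -> m <= Derive psi t).
  { intros t Ht.
    assert (Hle : - Derive psi t <= - m); [|lra].
    apply (derive_nonneg_le (fun s => - Derive psi s) (fun s => - Derive (Derive psi) s)).
    - intros s _. apply (is_derive_opp (Derive psi)). apply Derive_correct.
      apply (ifs_derivable2 _ _ _ _ _ hpsi).
    - intros s Hs. assert (Derive (Derive psi) s <= 0) by (apply Hneg; lra). lra.
    - exact Ht. }
  assert (Hp := ifs_pos _ _ _ _ _ hpsi).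
  (* The zero of the tangent to [psi] at [x]. As [psi' >= m] to the left of [x], the graph lies
     below this tangent there, which forces [psi y <= 0]. *)
  set (y := x - psi x / m).
  assert (Hy : y <= x).
  { unfold y. assert (0 < psi x / m) by now apply Rdiv_lt_0_compat. lra. }
  assert (Hle : psi y - m * y <= psi x - m * x).
  { apply (derive_nonneg_le (fun s => psi s - m * s) (fun s => Derive psi s - m)).
    - intros s _. assert (Hs := ifs_derivable _ _ _ _ _ hpsi s).
      auto_derive; [exact Hs|].
      change (Derive (fun x => psi x) s) with (Derive psi s). ring.
    - intros s Hs. assert (m <= Derive psi s) by (apply Hw; lra). lra.
    - exact Hy. }
  assert (E : m * y = m * x - psi x) by (unfold y; field; lra).
  specialize (Hp y). lra.
Qed.

(** The Newton map of [psi], called [G] in the overview. It is free of [ell], [lam], [c] and [k],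
    which enter the threshold equation through [beta] alone. *)
Definition threshold_map (x : R) : R := x - psi x / Derive psi x.

Lemma is_derive_threshold_map (x : R) :
  is_derive threshold_map x (psi x * Derive_n psi 2 x / Derive psi x ^ 2).
Proof.
  assert (Hp := ifs_derive_pos x).
  assert (H1 := ifs_derivable _ _ _ _ _ hpsi x).
  assert (H2 := ifs_derivable2 _ _ _ _ _ hpsi x).
  rewrite Derive_n_2. unfold threshold_map. auto_derive.
  - change (Derive (fun x => psi x) x) with (Derive psi x).
    repeat split; auto. lra.
  - change (Derive (fun x => psi x) x) with (Derive psi x).
    change (Derive (fun x => Derive psi x) x) with (Derive (Derive psi) x).
    field. lra.
Qed.

Lemma threshold_map_derive_pos (x : R) :
  0 < psi x * Derive_n psi 2 x / Derive psi x ^ 2.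
Proof.
  apply Rdiv_lt_0_compat.
  - apply Rmult_lt_0_compat; [apply (ifs_pos _ _ _ _ _ hpsi)|apply ifs_derive2_pos].
  - apply pow_lt, ifs_derive_pos.
Qed.

Lemma threshold_equation_map (bet x : R) :
  threshold_equation psi bet x -> threshold_map x = bet.
Proof.
  unfold threshold_equation, threshold_map. intros H.
  assert (Hp := ifs_derive_pos x).
  replace (psi x) with ((x - bet) * Derive psi x) by lra. field. lra.
Qed.

End FundamentalSolution.

(** * Differentiating an implicitly given inverse *)

Lemma filterlim_diff_quotient (f : R -> R) (x l : R) :
  is_derive f x l <->
  filterlim (fun y => (f y - f x) / (y - x)) (locally' x) (locally l).
Proof.
  rewrite is_derive_Reals. split.
  - intros H P [eps HP].
    destruct (H eps (cond_pos eps)) as [d Hd].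
    exists d. intros y Hy Hne. apply HP.
    specialize (Hd (y - x)).
    rewrite Rplus_minus in Hd.
    apply Hd; [now apply Rminus_eq_contra|exact Hy].
  - intros H eps Heps.
    destruct (H (ball l eps)) as [d Hd]; [now exists (mkposreal eps Heps)|].
    exists d. intros h Hh Hlt.
    assert (Eh : forall u v : R, u + v - u = v) by (intros; ring).
    specialize (Hd (x + h)). rewrite (Eh x h) in Hd.
    apply Hd; [|lra].
    change (Rabs (x + h - x) < d). now rewrite (Eh x h).
Qed.

(** For [p] near [p0], [B p] lies strictly between the values of [G] at [f p0 - eps] and
    [f p0 + eps]; monotonicity of [G] then traps [f p] between these two points. *)
Lemma monotone_inverse_continuous (G f B : R -> R) (p0 : R) :
  (forall x y, x < y -> G x < G y) ->
  locally p0 (fun p => G (f p) = B p) ->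
  continuous B p0 -> continuous f p0.
Proof.
  intros Hinc Heq HB P [eps HP].
  assert (He := cond_pos eps).
  assert (E0 : G (f p0) = B p0) by now apply locally_singleton in Heq.
  assert (L : locally p0 (fun p => G (f p0 - eps) < B p < G (f p0 + eps))).
  { apply (HB (fun z => G (f p0 - eps) < z < G (f p0 + eps))).
    apply (locally_interval _ _ (Finite (G (f p0 - eps))) (Finite (G (f p0 + eps))));
      simpl; try (rewrite <- E0; apply Hinc; lra). tauto. }
  unfold filtermap. generalize (filter_and _ _ Heq L). apply filter_imp.
  intros p [Ep [H1 H2]]. apply HP. rewrite <- Ep in H1, H2.
  assert (Hrev : forall x y, G x < G y -> x < y).
  { intros x y Hxy. destruct (Rtotal_order x y) as [H|[H|H]]; [exact H| |].
    - subst. lra.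
    - apply Hinc in H. lra. }
  apply Hrev in H1. apply Hrev in H2.
  apply Rabs_def1; unfold minus, plus, opp; simpl; lra.
Qed.

(** Carathéodory's argument: [G y - G x0 = phi y * (y - x0)] with [phi] positive and continuous at
    [x0]. Hence the difference quotient of [f] is that of [B] divided by [phi (f p)]. *)
Lemma is_derive_monotone_inverse (G dG f B : R -> R) (p0 dB : R) :
  (forall x, is_derive G x (dG x)) -> (forall x, 0 < dG x) ->
  locally p0 (fun p => G (f p) = B p) ->
  is_derive B p0 dB -> is_derive f p0 (dB / dG (f p0)).
Proof.
  intros HG Hpos Heq HB.
  assert (Hinc := derive_pos_lt G dG HG Hpos).
  assert (Hf : continuous f p0).
  { apply monotone_inverse_continuous with G B; auto.
    apply (ex_derive_continuous B). now exists dB. }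
  set (x0 := f p0).
  (* The value at [x0] makes [phi] continuous there, so the case [f p = x0] with [p] different from
     [p0] needs no separate treatment. *)
  set (phi := fun y => if Req_dec_T y x0 then dG x0 else (G y - G x0) / (y - x0)).
  assert (Hphi : filterlim phi (locally x0) (locally (dG x0))).
  { intros P HP.
    assert (HQ := proj1 (filterlim_diff_quotient G x0 (dG x0)) (HG x0) P HP).
    unfold filtermap, locally', within in HQ |- *.
    generalize HQ. apply filter_imp. intros y Hy. unfold phi.
    destruct (Req_dec_T y x0); [now apply locally_singleton|now apply Hy]. }
  assert (Hphi_pos : forall y, 0 < phi y).
  { intros y. unfold phi. destruct (Req_dec_T y x0) as [->|Hne]; [apply Hpos|].
    destruct (Rlt_le_dec y x0) as [Hlt|Hle].
    - assert (G y < G x0) by now apply Hinc.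
      replace ((G y - G x0) / (y - x0)) with ((G x0 - G y) / (x0 - y)) by (field; lra).
      apply Rdiv_lt_0_compat; lra.
    - assert (G x0 < G y) by (apply Hinc; lra). apply Rdiv_lt_0_compat; lra. }
  assert (Hfac : forall y, G y - G x0 = phi y * (y - x0)).
  { intros y. unfold phi. destruct (Req_dec_T y x0) as [->|Hne]; [ring|field; lra]. }
  apply filterlim_diff_quotient.
  assert (E0 : G x0 = B p0) by now apply locally_singleton in Heq.
  apply (filterlim_ext_loc (fun p => (B p - B p0) / (p - p0) * / phi (f p))).
  { unfold locally', within. generalize Heq. apply filter_imp. intros p Ep Hne.
    rewrite <- Ep, <- E0, Hfac. fold x0.
    specialize (Hphi_pos (f p)). field. split; lra. }
  apply (filterlim_comp_2 (G := locally dB) (H := locally (/ dG x0))).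
  - now apply filterlim_diff_quotient.
  - apply filterlim_comp with (locally (dG x0)).
    + apply filterlim_comp with (locally x0); [|exact Hphi].
      refine (filterlim_filter_le_1 _ _ Hf). apply filter_le_within.
    + specialize (Hpos x0). apply (filterlim_Rbar_inv (Finite (dG x0))).
      intros E. injection E. lra.
  - apply (filterlim_mult dB (/ dG x0)).
Qed.

(** * Sensitivities of the threshold to the four parameters *)

Theorem mainTheorem2
  (a b sigma rho I : R) (psi : R -> R) (xstar : R -> R -> R -> R -> R)
  (hb : 0 < b) (hsigma : 0 < sigma) (hrho : 0 < rho)
  (hpsi : increasing_fundamental_solution a b sigma rho psi)
  (hxstar : forall ell lam c k : R,
     0 < ell -> 0 < lam -> 0 < c -> 0 < k < I ->
     threshold_equation psi (beta a b rho I ell lam c k) (xstar ell lam c k))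
  (ell lam c k : R)
  (hell : 0 < ell) (hlam : 0 < lam) (hc : 0 < c) (hk : 0 < k < I) :
  let xs := xstar ell lam c k in
  let Q := (Derive psi xs) ^ 2 / (psi xs * Derive_n psi 2 xs) in
  (is_derive (fun l => xstar l lam c k) ell
     (- Q * ((rho + b) / ell ^ 2) * (I - k - lam * c / rho))
   /\ (0 < I - k - lam * c / rho -> Derive (fun l => xstar l lam c k) ell < 0)
   /\ (I - k - lam * c / rho < 0 -> 0 < Derive (fun l => xstar l lam c k) ell))
  /\
  (is_derive (fun l => xstar ell l c k) lam
     (- Q * (c / rho) * ((rho + b) / ell))
   /\ Derive (fun l => xstar ell l c k) lam < 0)
  /\
  (is_derive (fun d => xstar ell lam d k) c
     (- Q * (lam / rho) * ((rho + b) / ell))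
   /\ Derive (fun d => xstar ell lam d k) c < 0)
  /\
  (is_derive (fun q => xstar ell lam c q) k
     (- Q * ((rho + b) / ell))
   /\ Derive (fun q => xstar ell lam c q) k < 0).
Proof.
  intros xs Q.
  set (dG := fun x => psi x * Derive_n psi 2 x / Derive psi x ^ 2).
  assert (HdG : forall x, 0 < dG x).
  { exact (threshold_map_derive_pos a b sigma rho psi hb hsigma hrho hpsi). }
  (* Common to all four parameters: [Q] is the reciprocal of the derivative of [threshold_map] at
     [xs], so only the derivative of [beta] remains to be computed. The equation is asked only near
     [p0], as it holds on the admissible open range of each parameter. *)
  assert (Main : forall f B p0 dB, f p0 = xs ->
    locally p0 (fun p => threshold_equation psi (B p) (f p)) ->
    is_derive B p0 dB -> is_derive f p0 (dB * Q)).
  { intros f B p0 dB Ef Hloc HB.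
    replace (dB * Q) with (dB / dG (f p0)).
    - apply is_derive_monotone_inverse with (threshold_map psi) B; auto.
      + exact (is_derive_threshold_map a b sigma rho psi hrho hpsi).
      + generalize Hloc. apply filter_imp. intros p.
        exact (threshold_equation_map a b sigma rho psi hrho hpsi _ _).
    - assert (H1 := ifs_derive_pos a b sigma rho psi hrho hpsi xs).
      assert (H2 := ifs_derive2_pos a b sigma rho psi hb hsigma hrho hpsi xs).
      assert (H3 := ifs_pos _ _ _ _ _ hpsi xs).
      rewrite Ef. unfold dG, Q. rewrite Derive_n_2. field. repeat split; lra. }
  assert (HQ : 0 < Q).
  { replace Q with (/ dG xs); [now apply Rinv_0_lt_compat|].
    unfold dG, Q. now rewrite Rinv_div. }
  assert (Hl : 0 < (rho + b) / ell) by (apply Rdiv_lt_0_compat; lra).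
  assert (Hl2 : 0 < (rho + b) / ell ^ 2).
  { apply Rdiv_lt_0_compat; [lra|]. now apply pow_lt. }
  assert (Hpos : forall p0, 0 < p0 -> locally p0 (fun p => 0 < p)).
  { intros p0 Hp. now apply (open_gt 0). }
  assert (D1 : is_derive (fun l => xstar l lam c k) ell
     (- Q * ((rho + b) / ell ^ 2) * (I - k - lam * c / rho))).
  { replace (- Q * ((rho + b) / ell ^ 2) * (I - k - lam * c / rho))
      with ((- ((rho + b) / ell ^ 2) * (I - k - lam * c / rho)) * Q) by ring.
    apply Main with (fun l => beta a b rho I l lam c k); [reflexivity| |].
    - generalize (Hpos ell hell). apply filter_imp. intros l Hll. now apply hxstar.
    (* In [beta] the term with [a / b * (ell / rho)] is constant in [ell] after multiplication by
       [(rho + b) / ell], so the derivative keeps only [I - k - lam * c / rho]. *)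
    - unfold beta. auto_derive; [lra|]. field. repeat split; lra. }
  assert (D2 : is_derive (fun l => xstar ell l c k) lam
     (- Q * (c / rho) * ((rho + b) / ell))).
  { replace (- Q * (c / rho) * ((rho + b) / ell))
      with ((- (c / rho) * ((rho + b) / ell)) * Q) by ring.
    apply Main with (fun l => beta a b rho I ell l c k); [reflexivity| |].
    - generalize (Hpos lam hlam). apply filter_imp. intros l Hll. now apply hxstar.
    - unfold beta. auto_derive; [exact Logic.I|]. field. repeat split; lra. }
  assert (D3 : is_derive (fun d => xstar ell lam d k) c
     (- Q * (lam / rho) * ((rho + b) / ell))).
  { replace (- Q * (lam / rho) * ((rho + b) / ell))
      with ((- (lam / rho) * ((rho + b) / ell)) * Q) by ring.
    apply Main with (fun d => beta a b rho I ell lam d k); [reflexivity| |].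
    - generalize (Hpos c hc). apply filter_imp. intros d Hd. now apply hxstar.
    - unfold beta. auto_derive; [exact Logic.I|]. field. repeat split; lra. }
  assert (D4 : is_derive (fun q => xstar ell lam c q) k
     (- Q * ((rho + b) / ell))).
  { replace (- Q * ((rho + b) / ell)) with ((- ((rho + b) / ell)) * Q) by ring.
    apply Main with (fun q => beta a b rho I ell lam c q); [reflexivity| |].
    - apply (locally_interval _ _ (Finite 0) (Finite I)); simpl; try lra.
      intros q H1 H2. now apply hxstar.
    - unfold beta. auto_derive; [exact Logic.I|]. field. repeat split; lra. }
  assert (Hneg : forall u v, 0 < u -> 0 < v -> - Q * u * v < 0).
  { intros u v Hu Hv.
    assert (H := Rmult_lt_0_compat _ _ (Rmult_lt_0_compat _ _ HQ Hu) Hv). lra. }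
  split; [|split; [|split]].
  - split; [exact D1|].
    assert (E : Derive (fun l => xstar l lam c k) ell = _) by exact (is_derive_unique _ _ _ D1).
    rewrite E. split; intros H.
    + now apply Hneg.
    + assert (H' := Hneg _ (- (I - k - lam * c / rho)) Hl2). lra.
  - split; [exact D2|].
    assert (E : Derive (fun l => xstar ell l c k) lam = _) by exact (is_derive_unique _ _ _ D2).
    rewrite E.
    apply Hneg; [now apply Rdiv_lt_0_compat|exact Hl].
  - split; [exact D3|].
    assert (E : Derive (fun d => xstar ell lam d k) c = _) by exact (is_derive_unique _ _ _ D3).
    rewrite E.
    apply Hneg; [now apply Rdiv_lt_0_compat|exact Hl].
  - split; [exact D4|].
    assert (E : Derive (fun q => xstar ell lam c q) k = _) by exact (is_derive_unique _ _ _ D4).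
    rewrite E.
    (* The factor 1 stands in for the [c / rho] or [lam / rho] of the two preceding cases. *)
    assert (H := Hneg 1 _ Rlt_0_1 Hl). lra.
Qed.
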